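(* Consider the simple linear regression model $Y_i=\alpha+\beta x_i+\varepsilon_i$, $i=1,\dots,n$, with true parameter $\theta_0=(\alpha,\beta)'$, where $x_1,\dots,x_n$ are fixed real numbers, not all equal, and the errors $\varepsilon_1,\dots,\varepsilon_n$ are independent and identically distributed with mean $0$, variance $\sigma^2=\mu_2>0$, and finite sixth moment; $\mu_k$ denotes the $k$-th central moment of the error distribution. Then the $L_4$ estimator of $\theta_0$ performs better than the ordinary least squares (OLS) estimator in terms of precision (that is, $V_2-V_4$ is positive definite, where $V_4$ and $V_2$ are the asymptotic covariance matrices of the two estimators as defined in the context) if and only if $$\frac{\mu_6-\mu_3^2}{\mu_2^3}<9 .$$
   Context: The OLS estimator minimizes $S_2(\alpha,\beta)=\sum_{i=1}^n (Y_i-\alpha-\beta x_i)^2$ over $(\alpha,\beta)$; the $L_4$ estimator minimizes $S_4(\alpha,\beta)=\sum_{i=1}^n (Y_i-\alpha-\beta x_i)^4$. Precision is measured by the asymptotic covariance matrix of each estimator. Put $$S=\begin{pmatrix} n & \sum_{i=1}^n x_i\\ \sum_{i=1}^n x_i & \sum_{i=1}^n x_i^2\end{pmatrix}.$$ For OLS the asymptotic covariance matrix is $V_2=\sigma^2 S^{-1}$. For the $L_4$ estimator it is given by the M-estimator (sandwich) formula $$V_4=A(\theta_0)^{-1}B(\theta_0)\,[A(\theta_0)^{-1}]',$$ where, with $\theta=(\alpha,\beta)'$, $$\psi(Y,\theta)=\frac{\partial S_4}{\partial\theta}=-4\begin{pmatrix}\sum_{i=1}^n (Y_i-\alpha-\beta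 x_i)^3\\ \sum_{i=1}^n (Y_i-\alpha-\beta x_i)^3x_i\end{pmatrix},$$ $$A(\theta_0)=E\!\left[\frac{\partial}{\partial\theta}\psi(Y,\theta_0)\right],\qquad B(\theta_0)=E[\psi(Y,\theta_0)\psi(Y,\theta_0)']-E[\psi(Y,\theta_0)]\,E[\psi(Y,\theta_0)]'.$$ Here $\frac{\partial}{\partial\theta}\psi$ is the $2\times 2$ Jacobian matrix, and expectations are under the model with true parameter $\theta_0$. *)

(* Defs.v *)
From HB Require Import structures.
From mathcomp Require Import all_boot all_order all_algebra.
From mathcomp Require Import all_classical all_reals all_analysis.
From mathcomp Require Import ring.

Set Implicit Arguments.
Unset Strict Implicit.
Unset Printing Implicit Defensive.

Import Order.TTheory GRing.Theory Num.Theory.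
Import numFieldNormedType.Exports.

Local Open Scope classical_set_scope.
Local Open Scope ring_scope.

Section LinearAlgebra.
Context {R : realType}.

Definition posdefmx k (M : 'M[R]_k) : Prop :=
  M^T = M /\ forall u : 'cV[R]_k, u != 0 -> 0 < (u^T *m M *m u) 0 0.

Definition gradient k (f : 'cV[R]_k.+1 -> R) (theta : 'cV[R]_k.+1) :
    'cV[R]_k.+1 :=
  \col_i 'D_(delta_mx i 0) f theta.

(* Entry (i, j) is the derivative of the i-th component in the j-th variable;
   the library's [jacobian] acts on row vectors and is the transpose of this. *)
Definition col_jacobian k (f : 'cV[R]_k.+1 -> 'cV[R]_k.+1)
    (theta : 'cV[R]_k.+1) : 'M[R]_k.+1 :=
  \matrix_(i, j) 'D_(delta_mx j 0) (fun t => f t i 0) theta.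

End LinearAlgebra.

Section Probability.
Context {d : measure_display} {T : measurableType d} {R : realType}.
Variable P : probability T R.

Definition mutually_independent n (X : 'I_n -> {RV P >-> R}) : Prop :=
  forall (J : {set 'I_n}) (E : 'I_n -> set R),
    (forall i, measurable (E i)) ->
    P (\bigcap_(i in [set` J]) (X i @^-1` E i)) =
    (\prod_(i in J) P (X i @^-1` E i))%E.

Definition iid n (X : 'I_n -> {RV P >-> R})
    (law : probability R R) : Prop :=
  mutually_independent X /\
  forall i (E : set R), measurable E -> distribution P (X i) E = law E.

(* [fine] sends an infinite expectation to 0, so this is meaningful only when
   all entries are integrable. *)
Definition expectation_mx m k (M : T -> 'M[R]_(m, k)) : 'M[R]_(m, k) :=
  \matrix_(i, j) fine 'E_P[fun w => M w i j].

(* Asymptotic covariance of the M-estimator with estimating function [psi],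
   for data [Y] generated under the parameter [theta0]. *)
Definition sandwich_A {D : Type} k (psi : D -> 'cV[R]_k.+1 -> 'cV[R]_k.+1)
    (Y : T -> D) (theta0 : 'cV[R]_k.+1) : 'M[R]_k.+1 :=
  expectation_mx (fun w => col_jacobian (psi (Y w)) theta0).

Definition sandwich_B {D : Type} k (psi : D -> 'cV[R]_k.+1 -> 'cV[R]_k.+1)
    (Y : T -> D) (theta0 : 'cV[R]_k.+1) : 'M[R]_k.+1 :=
  expectation_mx (fun w => psi (Y w) theta0 *m (psi (Y w) theta0)^T)
  - expectation_mx (fun w => psi (Y w) theta0)
    *m (expectation_mx (fun w => psi (Y w) theta0))^T.

Definition sandwich {D : Type} k (psi : D -> 'cV[R]_k.+1 -> 'cV[R]_k.+1)
    (Y : T -> D) (theta0 : 'cV[R]_k.+1) : 'M[R]_k.+1 :=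
  invmx (sandwich_A psi Y theta0) *m sandwich_B psi Y theta0
  *m (invmx (sandwich_A psi Y theta0))^T.

(* Same caveat on [fine] as for [expectation_mx]. *)
Definition central_moment (X : T -> R) (k : nat) : R :=
  fine 'E_P[fun w => (X w - fine 'E_P[X]) ^+ k].

End Probability.

Section Regression.
Context {R : realType}.

Definition param (alpha beta : R) : 'cV[R]_2 :=
  \col_i (if i == 0 then alpha else beta).

Section FixedDesign.
Variables (n : nat) (x : 'I_n -> R).

Definition design_matrix : 'M[R]_2 :=
  \matrix_(i, j)
    if (i == 0) && (j == 0) then n%:R
    else if (i == 1) && (j == 1) then \sum_(k < n) x k ^+ 2
    else \sum_(k < n) x k.

Definition S4 (Y : 'I_n -> R) (theta : 'cV[R]_2) : R :=
  \sum_(i < n) (Y i - theta 0 0 - theta 1 0 * x i) ^+ 4.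

Definition psi4 (Y : 'I_n -> R) (theta : 'cV[R]_2) : 'cV[R]_2 :=
  gradient (S4 Y) theta.

Definition V2 (sigma2 : R) : 'M[R]_2 := sigma2 *: invmx design_matrix.

Definition V4 {d : measure_display} {T : measurableType d}
    (P : probability T R) (Y : 'I_n -> T -> R) (theta0 : 'cV[R]_2) :
    'M[R]_2 :=
  sandwich P psi4 (fun w i => Y i w) theta0.

Lemma psi4E (Y : 'I_n -> R) (theta : 'cV[R]_2) :
  let r i := Y i - theta 0 0 - theta 1 0 * x i in
  psi4 Y theta =
  - 4 *: param (\sum_(i < n) r i ^+ 3) (\sum_(i < n) r i ^+ 3 * x i).
Proof.
move=> r; apply/matrixP => i j; rewrite {j}(ord1 j) /psi4 /gradient !mxE.
pose c k : R := if i == 0 then 1 else x k.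
have lineE h k : Y k - (h *: delta_mx i 0 + theta) 0 0
    - (h *: delta_mx i 0 + theta) 1 0 * x k = r k - h * c k.
  rewrite /r /c !mxE; case: i {c} => -[|[|//]] Hi /=; rewrite ?mulr1 ?mulr0.
  - ring.
  - ring.
have -> : 'D_(delta_mx i 0) (S4 Y) theta =
    'D_1 (fun h : R => \sum_(k < n) (r k - h * c k) ^+ 4) 0.
  pose g (h : R) : R := \sum_(k < n) (r k - h * c k) ^+ 4.
  suff E : (fun h : R => h^-1 *:
      ((S4 Y \o shift theta) (h *: delta_mx i 0) - S4 Y theta)) =
      (fun h : R => h^-1 *: ((g \o shift 0) (h *: (1 : R)) - g 0)).
    by rewrite /derive E.
  apply/funext => h /=; congr (_ *: (_ - _)); rewrite /S4 /g.
  - by apply: eq_bigr => k _; rewrite lineE addr0 /GRing.scale /= mulr1.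
  - by apply: eq_bigr => k _; rewrite mul0r subr0.
have dterm k : is_derive (0 : R) (1 : R)
    (fun h : R => (r k - h * c k) ^+ 4) (- 4 * (r k ^+ 3 * c k)).
  have -> : (fun h : R => (r k - h * c k) ^+ 4) =
      (cst (r k) - id * cst (c k)) ^+ 4 by apply/funext => h; rewrite exprfctE.
  apply: is_derive_eq; rewrite /GRing.scale /= !fctE /cst /=; ring.
have dsum : is_derive (0 : R) (1 : R)
    (\sum_(k < n) (fun h : R => (r k - h * c k) ^+ 4))
    (\sum_(k < n) - 4 * (r k ^+ 3 * c k)).
  exact: is_derive_sum.
have -> : (fun h : R => \sum_(k < n) (r k - h * c k) ^+ 4) =
    \sum_(k < n) (fun h : R => (r k - h * c k) ^+ 4).
  by apply/funext => h; rewrite fct_sumE.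
rewrite derive_val -mulr_sumr; congr (_ * _).
by rewrite /c; case: ifP => _; apply: eq_bigr => k _; rewrite ?mulr1.
Qed.

End FixedDesign.
End Regression.

(* Main.v *)
Require Import Defs.
From HB Require Import structures.
From mathcomp Require Import all_boot all_order all_algebra.
From mathcomp Require Import all_classical all_reals all_analysis.
From mathcomp Require Import measurable_realfun ring lra.

Import Order.TTheory GRing.Theory Num.Theory.
Import numFieldNormedType.Exports.

Local Open Scope classical_set_scope.
Local Open Scope ring_scope.

(** At the true parameter the residuals are the errors, so the expected
    Jacobian of [psi4] is [12 mu_2 S]. Independence kills the covariances of
    the cubes of distinct errors, so the covariance matrix of [psi4] is
    [16 (mu_6 - mu_3^2) S]. Hence [V4] and [V2] are both multiples of
    [S^-1], which is positive definite because the [x_i] are not all equal, and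
    the comparison reduces to that of the scalar factors
    [(mu_6 - mu_3^2) / (9 mu_2^2)] and [mu_2]. *)

(** * Positive definite matrices: inverses and scalar multiples *)

Section PositiveDefinite.
Context {R : realType}.

(** A row vector [v] with [v *m M = 0] makes the quadratic form vanish at [v^T], so the left kernel
    is trivial. *)
Lemma posdefmx_unit {k} (M : 'M[R]_k) : posdefmx M -> M \in unitmx.
Proof.
move=> [_ M_gt0]; rewrite -row_free_unit; apply: inj_row_free => v vM0.
apply/eqP/negPn/negP => v_neq0.
have : v^T != 0 by rewrite -trmx0 (inj_eq trmx_inj).
by move=> /M_gt0; rewrite trmxK vM0 mul0mx mxE ltxx.
Qed.

(** The substitution [u = M *m v] turns the form of the inverse at [u] into the form of [M] at
    [v]. *)
Lemma posdefmx_inv {k} (M : 'M[R]_k) : posdefmx M -> posdefmx (invmx M).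
Proof.
move=> M_pd; have Mu := posdefmx_unit _ M_pd; have [M_sym M_gt0] := M_pd.
split=> [|u u_neq0]; first by rewrite trmx_inv M_sym.
have -> : u^T *m invmx M *m u = (invmx M *m u)^T *m M *m (invmx M *m u).
  by rewrite trmx_mul trmx_inv M_sym -[RHS]mulmxA (mulKVmx Mu).
apply: M_gt0; apply: contra_neq u_neq0 => Mu0.
by rewrite -(mulKVmx Mu u) Mu0 mulmx0.
Qed.

(** The size is a successor because in dimension 0 positive definiteness is vacuous and says nothing
    about the sign of [c]; the all-ones vector serves as nonzero test vector. *)
Lemma posdefmx_scale {k} (M : 'M[R]_k.+1) (c : R) :
  posdefmx M -> posdefmx (c *: M) <-> 0 < c.
Proof.
move=> [M_sym M_gt0]; split=> [[_ cM_gt0]|c_gt0].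
  have e_neq0 : (const_mx 1 : 'cV[R]_k.+1) != 0.
    by apply/eqP => /matrixP/(_ 0 0); rewrite !mxE; apply/eqP/oner_neq0.
  have := cM_gt0 _ e_neq0; rewrite -scalemxAr -scalemxAl mxE.
  by rewrite pmulr_lgt0// M_gt0.
split=> [|u /M_gt0 Mu_gt0]; first by rewrite linearZ/= M_sym.
by rewrite -scalemxAr -scalemxAl mxE mulr_gt0.
Qed.

End PositiveDefinite.

(** * The design matrix and the derivatives of the quartic criterion *)

Section Design.
Context {R : realType} {n : nat}.
Implicit Types (x Y : 'I_n -> R) (theta : 'cV[R]_2).

(** The pair [(1, x k)] as a function of the coordinate, so that intercept and slope are handled by
    one formula. *)
Definition regressor x (k : 'I_n) (i : 'I_2) : R := if i == 0 then 1 else x k.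

Definition residual x Y theta (k : 'I_n) : R :=
  Y k - theta 0 0 - theta 1 0 * x k.

(** This exhibits [S] as the Gram matrix of the regressors. *)
Lemma design_matrixE x i j :
  design_matrix x i j = \sum_(k < n) regressor x k i * regressor x k j.
Proof.
have ord2 (a : 'I_2) : a = 0 \/ a = 1.
  by case: a => -[|[|//]] ?; [left|right]; apply/val_inj.
rewrite mxE /regressor.
case: (ord2 i) => ->; case: (ord2 j) => -> /=.
- by under eq_bigr do rewrite mulr1; rewrite sumr_const card_ord.
- by under [RHS]eq_bigr do rewrite mul1r.
- by under [RHS]eq_bigr do rewrite mulr1.
- by under [LHS]eq_bigr do rewrite expr2.
Qed.

(** The quadratic form is a sum of squares of the values at the [x k] of the affine function with
    coefficients [u]. If it vanishes, this function has two distinct zeros, hence is zero. *)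
Lemma design_matrix_posdef x :
  (exists i j, x i != x j) -> posdefmx (design_matrix x).
Proof.
move=> [i [j xij]]; split=> [|u u_neq0].
  apply/matrixP => a b; rewrite mxE !design_matrixE.
  by apply: eq_bigr => k _; rewrite mulrC.
have -> : (u^T *m design_matrix x *m u) 0 0 =
    \sum_(k < n) (u 0 0 + u 1 0 * x k) ^+ 2.
  rewrite !mxE !big_ord_recl big_ord0 !mxE !big_ord_recl !big_ord0.
  rewrite !design_matrixE !mxE /regressor /=.
  rewrite !addr0 !mulr_sumr -!big_split/= !mulr_suml -!big_split/=.
  apply: eq_bigr => k _.
  rewrite (_ : lift ord0 ord0 = 1 :> 'I_2); last exact/val_inj.
  ring.
rewrite lt_neqAle sumr_ge0 ?andbT; last by move=> k _; exact: sqr_ge0.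
apply: contra_neq u_neq0 => /esym/eqP.
rewrite psumr_eq0; last by move=> k _; exact: sqr_ge0.
move=> /allP u0.
have lin0 k : u 0 0 + u 1 0 * x k = 0.
  by apply/eqP; rewrite -sqrf_eq0; apply: u0; rewrite mem_index_enum.
have u1 : u 1 0 = 0.
  have /eqP : u 1 0 * (x i - x j) = 0 by have := lin0 i; have := lin0 j; lra.
  by rewrite mulf_eq0 subr_eq0 (negbTE xij) orbF => /eqP.
have u00 : u 0 0 = 0 by have := lin0 i; rewrite u1 mul0r addr0.
apply/matrixP => a b; rewrite (ord1 b) mxE.
by case: a => -[|[|//]] ?; [rewrite -[RHS]u00|rewrite -[RHS]u1];
  congr (u _ _); apply/val_inj.
Qed.

Lemma psi4_coord x Y theta i :
  psi4 x Y theta i 0 =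
  \sum_(k < n) - 4 * regressor x k i * residual x Y theta k ^+ 3.
Proof.
rewrite psi4E !mxE -/(residual x Y theta) /regressor.
case: ifP => _; rewrite mulr_sumr; apply: eq_bigr => k _;
  rewrite /residual; ring.
Qed.

(** Along the direction of coordinate [j] each residual is affine in the step [h] with slope
    [- regressor x k j], so a one-variable derivative suffices; 12 is [(-4) * 3 * (-1)]. *)
Lemma psi4_jacobian x Y theta i j :
  col_jacobian (psi4 x Y) theta i j =
  \sum_(k < n) 12 * (regressor x k i * regressor x k j)
    * residual x Y theta k ^+ 2.
Proof.
rewrite mxE.
set c := regressor x; set r := residual x Y theta.
have lineE h k :
    residual x Y (h *: delta_mx j 0 + theta) k = r k - h * c k j.
  rewrite /r /c /residual /regressor !mxE.
  by case: j => -[|[|//]] Hj /=; rewrite ?mulr1 ?mulr0; ring.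
pose g (h : R) : R := \sum_(k < n) - 4 * c k i * (r k - h * c k j) ^+ 3.
have -> : 'D_(delta_mx j 0) (fun t => psi4 x Y t i 0) theta = 'D_1 g 0.
  suff E : (fun h : R => h^-1 *:
      (((fun t => psi4 x Y t i 0) \o shift theta) (h *: delta_mx j 0)
        - psi4 x Y theta i 0)) =
      (fun h : R => h^-1 *: ((g \o shift 0) (h *: (1 : R)) - g 0)).
    by rewrite /derive E.
  apply/funext => h /=; congr (_ *: (_ - _)); rewrite psi4_coord /g.
  - by apply: eq_bigr => k _; rewrite lineE addr0 /GRing.scale /= mulr1.
  - by apply: eq_bigr => k _; rewrite mul0r subr0.
have dterm k : is_derive (0 : R) (1 : R)
    (fun h : R => - 4 * c k i * (r k - h * c k j) ^+ 3)
    (12 * (c k i * c k j) * r k ^+ 2).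
  have -> : (fun h : R => - 4 * c k i * (r k - h * c k j) ^+ 3) =
      cst (- 4 * c k i) * (cst (r k) - id * cst (c k j)) ^+ 3.
    by apply/funext => h; rewrite !fctE.
  apply: is_derive_eq; rewrite /GRing.scale /= !fctE /cst /=; ring.
have -> : g = \sum_(k < n) (fun h : R => - 4 * c k i * (r k - h * c k j) ^+ 3).
  by apply/funext => h; rewrite fct_sumE.
have dsum := is_derive_sum dterm; exact: derive_val.
Qed.

End Design.

(** * Integrability, change of variables and independent products *)

Section Expectation.
Context {d : measure_display} {T : measurableType d} {R : realType}.
Variable P : probability T R.
Implicit Types X Y : T -> R.

(** Stated over any finite type, since it serves sums over observations and over pairs of
    observations. Integrability keeps every expectation finite, which makes [fine] additive here. *)
Lemma fine_expectation_sum {I : finType} (a : I -> R) (X : I -> T -> R) :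
  (forall i, P.-integrable setT (EFin \o X i)) ->
  fine 'E_P[fun w => \sum_i a i * X i w] = \sum_i a i * fine 'E_P[X i].
Proof.
move=> X_int; rewrite unlock.
have -> : (\int[P]_w (\sum_i a i * X i w)%R%:E =
    \int[P]_w (\sum_(i : I) ((a i)%:E * (X i w)%:E)))%E.
  by apply: eq_integral => w _; rewrite -sumEFin.
rewrite integral_sum//; last first.
  by move=> i; exact: (integrableZl measurableT (a i) (X_int i)).
under eq_bigr => i _ do rewrite (integralZl measurableT (X_int i)).
rewrite -sum_fine.
  by apply: eq_bigr => i _; rewrite fineM//; exact: integrable_fin_num.
by move=> i _; rewrite fin_numM//; exact: integrable_fin_num.
Qed.

(** The power [|X| ^+ k] is dominated by [|X| ^+ m + 1]: by the first term where [|X|] is at least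
    1, by the second elsewhere. *)
Lemma integrable_exp_le X m k : measurable_fun setT X -> (k <= m)%N ->
  P.-integrable setT (EFin \o (fun w => X w ^+ m)) ->
  P.-integrable setT (EFin \o (fun w => X w ^+ k)).
Proof.
move=> mX km Xm_int.
apply: (@le_integrable _ _ _ P _ measurableT _
  (EFin \o (fun w => `|X w ^+ m| + 1))).
- by apply/measurable_EFinP; exact: measurable_funX.
- move=> w _ /=; rewrite lee_fin !normrX.
  rewrite [X in _ <= X]ger0_norm; last by rewrite addr_ge0// exprn_ge0.
  have [X1|/ltW X1] := leP 1 `|X w|.
    by rewrite (le_trans (ler_weXn2l X1 km))// lerDl.
  by rewrite (le_trans (exprn_ile1 k (normr_ge0 _) X1))// lerDr exprn_ge0.
- by apply: eq_integrable (integrableD measurableT (integrable_abse Xm_int)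
    (finite_measure_integrable_cst P 1 measurableT)).
Qed.

(** Change of variables. The target space is arbitrary because it is used both for the law of one
    error and for the joint law of a pair. *)
Lemma integral_transfer {d'} {T' : measurableType d'} (nu : probability T' R)
    (X : T -> T') (f : T' -> \bar R) :
  measurable_fun setT X ->
  (forall E, measurable E -> pushforward P X E = nu E) ->
  nu.-integrable setT f ->
  P.-integrable setT (f \o X) /\ (\int[P]_w f (X w) = \int[nu]_y f y)%E.
Proof.
move=> mX X_law f_int; have mf := measurable_int _ f_int.
have lawE g : (\int[nu]_y g y = \int[pushforward P X]_y g y)%E.
  by apply: eq_measure_integral => E mE _; exact/esym/X_law.
have fX_int : P.-integrable setT (f \o X).
  apply/integrableP; split; first exact: measurableT_comp.
  have /integrableP[_] := f_int.
  by rewrite lawE ge0_integral_pushforward//; exact: measurableT_comp.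
by split => //; rewrite lawE integral_pushforward.
Qed.

(** Independence makes the joint law agree with the product law on rectangles, hence everywhere;
    Fubini then splits the integral of the product. *)
Lemma expectation_indepM (X Y : {RV P >-> R}) :
  (forall A B, measurable A -> measurable B ->
     P (X @^-1` A `&` Y @^-1` B) = P (X @^-1` A) * P (Y @^-1` B))%E ->
  P.-integrable setT (EFin \o X) -> P.-integrable setT (EFin \o Y) ->
  P.-integrable setT (EFin \o (fun w => X w * Y w)) /\
  ('E_P[fun w => (X w * Y w)%R] = 'E_P[X] * 'E_P[Y])%E.
Proof.
move=> XY_indep X_int Y_int.
have mZ : measurable_fun setT (fun w => (X w, Y w)).
  exact: measurable_fun_pair.
pose Z : {RV P >-> _} :=
  HB.pack (fun w => (X w, Y w)) (isMeasurableFun.Build _ _ _ _ _ mZ).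
have Z_law E : measurable E ->
    pushforward P Z E = (distribution P X \x distribution P Y)%E E.
  move=> mE.
  by rewrite (@product_measure_unique _ _ _ _ _ _ _ (distribution P Z)).
pose f (z : R * R) : \bar R := (z.1 * z.2)%:E.
have mf : measurable_fun setT f.
  by apply/measurable_EFinP; exact: measurable_funM.
have dX_int : (distribution P X).-integrable setT (EFin : R -> \bar R).
  exact: integrable_pushforward.
have dY_int : (distribution P Y).-integrable setT (EFin : R -> \bar R).
  exact: integrable_pushforward.
(* By Tonelli the integral of [|x * y|] is the product of the two absolute first moments, both
   finite. *)
have f_int : (distribution P X \x distribution P Y)%E.-integrable setT f.
  apply/integrable12ltyP => //.
  under eq_integral => x _.
    under eq_integral => y _ do rewrite /f/= normrM EFinM.
    rewrite ge0_integralZl//; last exact: measurableT_comp.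
    over.
  rewrite ge0_integralZr//=; last 2 first.
    exact: measurableT_comp.
    exact: integral_ge0.
  rewrite lte_mul_pinfty//; first exact: integral_ge0.
    by have := integrable_abse dX_int => /integrable_fin_num; apply.
  by have /integrableP[] := dY_int.
have [fZ_int fZE] := integral_transfer _ _ _ mZ Z_law f_int.
split; first exact: fZ_int.
rewrite unlock fZE -integral12_prod_meas1// /fubini_F /f/=.
under eq_integral => x _.
  under eq_integral => y _ do rewrite EFinM.
  rewrite integralZl//.
  over.
(* The inner integral is a finite constant; it is written as a real number so that it can leave the
   outer integral. *)
rewrite /= -[X in (\int[_]_(_ in _) (_ * X))%E]fineK; last first.
  exact: integrable_fin_num.
rewrite integralZr// fineK; last exact: integrable_fin_num.
by rewrite !integral_distribution//.
Qed.

End Expectation.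

(** * Moments of the errors and the sandwich matrices *)

Section ErrorMoments.
Context {d : measure_display} {T : measurableType d} {R : realType}.
Variables (P : probability T R) (n : nat) (eps : 'I_n -> {RV P >-> R}).
Variable law : probability R R.
Hypothesis eps_iid : iid eps law.
Hypothesis sixth_moment : ('E_law[fun y : R => (`|y| ^+ 6)%R] < +oo)%E.

Local Notation m k := (fine 'E_law[fun y : R => (y ^+ k)%R]).

Lemma law_integrable_exp k : (k <= 6)%N ->
  law.-integrable setT (EFin \o (fun y : R => y ^+ k)).
Proof.
move=> k6; apply: (integrable_exp_le law (id : R -> R) 6) => //.
apply/integrableP; split.
  by apply/measurable_EFinP; exact: measurable_funX.
move: sixth_moment; rewrite unlock; congr (_ < _)%E.
by apply: eq_integral => y _ /=; rewrite normrX.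
Qed.

Lemma eps_moment i k : (k <= 6)%N ->
  P.-integrable setT (EFin \o (fun w => eps i w ^+ k)) /\
  fine 'E_P[fun w => eps i w ^+ k] = m k.
Proof.
move=> k6; have [_ eps_law] := eps_iid.
have [int_eps E_eps] := integral_transfer P law (eps i) _
  (measurable_funPT (eps i)) (eps_law i) (law_integrable_exp k k6).
by split; [exact: int_eps|rewrite unlock; congr fine; exact: E_eps].
Qed.

(** Mutual independence is applied to the index set of [i] and [j], with the event [A] at [i] and
    [B] at every other index. *)
Lemma iid_pair i j : i != j -> forall A B, measurable A -> measurable B ->
  (P (eps i @^-1` A `&` eps j @^-1` B) =
   P (eps i @^-1` A) * P (eps j @^-1` B))%E.
Proof.
move=> ij A B mA mB; have [eps_ind _] := eps_iid.
have := eps_ind [set i; j]%SET (fun k => if k == i then A else B).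
rewrite big_setU1 ?inE//= big_set1 eqxx eq_sym (negbTE ij) => <-.
  congr (P _); apply/seteqP; split=> [w [Aw Bw] k|w ABw].
    by rewrite /= !inE => /orP[]/eqP ->; rewrite ?eqxx// eq_sym (negbTE ij).
  split; first by have := ABw i; rewrite /= !inE eqxx; apply.
  by have := ABw j; rewrite /= !inE eqxx orbT eq_sym (negbTE ij); apply.
by move=> k; case: ifP.
Qed.

(** Subtracting the product of means [m 3 ^+ 2] leaves the covariance of the cubes, which the
    Kronecker factor confines to the diagonal. *)
Lemma eps_cube_mul i j :
  P.-integrable setT (EFin \o (fun w => eps i w ^+ 3 * eps j w ^+ 3)) /\
  fine 'E_P[fun w => eps i w ^+ 3 * eps j w ^+ 3] =
  m 3 ^+ 2 + (i == j)%:R * (m 6 - m 3 ^+ 2).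
Proof.
have [<-|ij] := eqVneq i j.
  have -> : (fun w => eps i w ^+ 3 * eps i w ^+ 3) = (fun w => eps i w ^+ 6).
    by apply/funext => w; rewrite -exprD.
  have [? ->] := eps_moment i 6 isT.
  by split=> //; rewrite mul1r addrC subrK.
have mcube k : measurable_fun setT (fun w => eps k w ^+ 3).
  exact: measurable_funX.
pose cube k : {RV P >-> R} :=
  HB.pack (fun w => eps k w ^+ 3) (isMeasurableFun.Build _ _ _ _ _ (mcube k)).
have mcubeR : measurable_fun setT (fun y : R => y ^+ 3).
  exact: measurable_funX.
have [int_i Ei] := eps_moment i 3 isT.
have [int_j Ej] := eps_moment j 3 isT.
(* An event on a cube is an event on the error itself, so the cubes inherit independence. *)
have cube_pre (A : set R) : measurable A ->
    measurable ((fun y : R => y ^+ 3) @^-1` A).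
  by move=> mA; rewrite -[X in measurable X]setTI; exact: mcubeR.
have [|int_ij Eij] := expectation_indepM P (cube i) (cube j) _ int_i int_j.
  move=> A B /cube_pre mA /cube_pre mB; exact: iid_pair ij _ _ mA mB.
split; first exact: int_ij.
rewrite mul0r addr0 [X in fine X]Eij fineM.
- by rewrite [X in X * _]Ei [X in _ * X]Ej expr2.
- by rewrite unlock; exact: integrable_fin_num.
- by rewrite unlock; exact: integrable_fin_num.
Qed.

Variables (x : 'I_n -> R) (Y : 'I_n -> T -> R) (theta0 : 'cV[R]_2).
Hypothesis residual_eps :
  forall k w, residual x (fun i => Y i w) theta0 k = eps k w.

Lemma psi4_A :
  sandwich_A P (psi4 x) (fun w i => Y i w) theta0 =
  (12 * m 2) *: design_matrix x.
Proof.
apply/matrixP => a b; rewrite mxE [RHS]mxE design_matrixE.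
under eq_fun => w.
  rewrite psi4_jacobian.
  under eq_bigr do rewrite residual_eps.
  over.
rewrite (fine_expectation_sum P
  (fun k => 12 * (regressor x k a * regressor x k b))
  (fun k w => eps k w ^+ 2)); last by move=> k; have [] := eps_moment k 2 isT.
rewrite mulr_sumr; apply: eq_bigr => k _.
by have [_ ->] := eps_moment k 2 isT; rewrite mulrAC.
Qed.

Lemma psi4_B :
  sandwich_B P (psi4 x) (fun w i => Y i w) theta0 =
  (16 * (m 6 - m 3 ^+ 2)) *: design_matrix x.
Proof.
have psiE w a j : psi4 x (fun i => Y i w) theta0 a j =
    \sum_(k < n) - 4 * regressor x k a * eps k w ^+ 3.
  by rewrite (ord1 j) psi4_coord; under eq_bigr do rewrite residual_eps.
have psi_mean a : fine 'E_P[fun w => psi4 x (fun i => Y i w) theta0 a 0] =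
    \sum_(k < n) - 4 * regressor x k a * m 3.
  under [X in 'E_P[X]%E]eq_fun do rewrite psiE.
  rewrite (fine_expectation_sum P (fun k => - 4 * regressor x k a)
    (fun k w => eps k w ^+ 3)); last by move=> k; have [] := eps_moment k 3 isT.
  by apply: eq_bigr => k _; have [_ ->] := eps_moment k 3 isT.
apply/matrixP => a b; rewrite [RHS]mxE design_matrixE !mxE big_ord1 !mxE.
rewrite !psi_mean.
under [X in 'E_P[X]%E]eq_fun => w.
  rewrite mxE big_ord1 [X in _ * X]mxE !psiE big_distrlr/= pair_bigA/=.
  under eq_bigr do rewrite mulrACA.
  over.
rewrite (fine_expectation_sum P
  (fun p : 'I_n * 'I_n => - 4 * regressor x p.1 a * (- 4 * regressor x p.2 b))
  (fun p w => eps p.1 w ^+ 3 * eps p.2 w ^+ 3)); last first.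
  by move=> p; have [] := eps_cube_mul p.1 p.2.
(* Back to a double sum, to be subtracted term by term from the expanded product of the means. *)
rewrite -(pair_bigA _ (fun k l =>
  - 4 * regressor x k a * (- 4 * regressor x l b) *
  fine 'E_P[fun w => eps k w ^+ 3 * eps l w ^+ 3]))/=.
rewrite big_distrlr/= -sumrB mulr_sumr; apply: eq_bigr => k _.
(* For fixed [k] only the term [l = k] survives the subtraction; its constant 16 is [(-4) ^+ 2]. *)
rewrite -sumrB (bigD1 k)//= big1 => [|l lk].
  by have [_ ->] := eps_cube_mul k k; rewrite eqxx mul1r; ring.
have [_ ->] := eps_cube_mul k l; rewrite eq_sym (negbTE lk) mul0r; ring.
Qed.

(** In the sandwich one [S] cancels one [S^-1], and the constants combine as
    [16 / 12 ^+ 2 = 1 / 9]. *)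
Lemma V4E : posdefmx (design_matrix x) -> 0 < m 2 ->
  V4 x P Y theta0 =
  ((m 6 - m 3 ^+ 2) / (9 * m 2 ^+ 2)) *: invmx (design_matrix x).
Proof.
move=> S_pd m2_gt0; have Su := posdefmx_unit _ S_pd; have [S_sym _] := S_pd.
have m2_neq0 : m 2 != 0 by rewrite gt_eqF.
rewrite /V4 /sandwich psi4_A psi4_B.
rewrite invmxZ; last by rewrite unitmxZ// unitfE mulf_neq0.
rewrite [X in _ *m X]linearZ/= trmx_inv S_sym -!scalemxAl -!scalemxAr !scalerA.
rewrite (mulVmx Su) -scalemxAl mul1mx scalerA; congr (_ *: _).
by field.
Qed.

End ErrorMoments.

(** * Comparison of the two asymptotic covariance matrices *)

Theorem theorem1 (R : realType) (d : measure_display) (T : measurableType d)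
    (P : probability T R) (n : nat) (x : 'I_n -> R)
    (x_not_all_equal : exists i j, x i != x j)
    (alpha beta : R)
    (eps : 'I_n -> {RV P >-> R}) (Y : 'I_n -> T -> R)
    (model : forall i w, Y i w = alpha + beta * x i + eps i w)
    (law : probability R R)
    (eps_iid : iid eps law)
    (mean0 : ('E_law[fun y : R => y] = 0)%E)
    (sigma2 : R) (sigma2_gt0 : 0 < sigma2)
    (variance_law : ('V_law[fun y : R => y] = sigma2%:E)%E)
    (sixth_moment : ('E_law[fun y : R => (`|y| ^+ 6)%R] < +oo)%E) :
  let mu := central_moment law (fun y : R => y) in
  posdefmx (V2 x sigma2 - V4 x P Y (param alpha beta)) <->
  (mu 6%N - mu 3%N ^+ 2) / mu 2%N ^+ 3 < 9.
Proof.
move=> mu.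
have S_pd := design_matrix_posdef _ x_not_all_equal.
(* Since the mean is zero, central moments are the raw moments used above. *)
have muE k : mu k = fine 'E_law[fun y : R => (y ^+ k)%R].
  rewrite /mu /central_moment mean0; congr (fine 'E_law[_]).
  by apply/funext => y; rewrite subr0.
have mu2 : mu 2 = sigma2.
  rewrite muE -[RHS]/(fine sigma2%:E) -variance_law /variance.
  rewrite covariance.unlock mean0; congr (fine 'E_law[_]).
  by apply/funext => y; rewrite !fctE /= subr0 expr2.
have residual_eps k w :
    residual x (fun i => Y i w) (param alpha beta) k = eps k w.
  by rewrite /residual !mxE/= model; ring.
have mu2_gt0 : 0 < mu 2 by rewrite mu2.
rewrite (V4E _ _ _ _ eps_iid sixth_moment x Y _ residual_eps S_pd); last first.
  by rewrite -muE.
rewrite -!muE /V2 -mu2 -scalerBl (posdefmx_scale _ _ (posdefmx_inv _ S_pd)).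
(* The positive factor [mu 2 / 9] is pulled out, so the sign is that of 9 minus the moment ratio. *)
have -> : mu 2 - (mu 6 - mu 3 ^+ 2) / (9 * mu 2 ^+ 2) =
    mu 2 / 9 * (9 - (mu 6 - mu 3 ^+ 2) / mu 2 ^+ 3).
  by field; rewrite gt_eqF.
by rewrite pmulr_rgt0 ?divr_gt0// subr_gt0.
Qed.
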